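(* Let $V$ be a symmetric vertex of degree $2n$, i.e. an origami vertex with $2n$ creases all of whose sector angles equal $360^\circ/(2n)=\pi/n$. Then the number of folding modes of its double-line pattern $DL(V,90^\circ)$, counted up to rotation, is $$\frac{1}{2n}\sum_{d\mid n}\phi(n/d)\binom{2d}{d},$$ where $\phi$ is Euler's totient function.
   Context: **Double-line pattern.** Let the creases of $V$ be rays in unit directions $e_0,\dots,e_{2n-1}$ in counterclockwise order, consecutive ones at angle $\pi/n$. Let $P=c_0c_1\cdots c_{2n-1}$ be a $2n$-gon around $V$ (vertices counterclockwise, indices mod $2n$) whose side $s_i=c_{i-1}c_i$ is perpendicular to $e_i$ and crosses the ray $e_i$. $DL(V,90^\circ)$ is the crease pattern consisting of the sides of $P$ and, for each $i$, the two parallel rays of direction $e_i$ emanating from $c_{i-1}$ and $c_i$. Each $c_i$ is a degree-4 vertex with sector angles $\pi/2,\ \pi/n,\ \pi/2,\ \pi-\pi/n$ in cyclic order, so its opposite sector angles are supplementary. **Vertex modes and speed coefficients.** Such a degree-4 vertex rigidly folds along two folding modes, along each of which the tangents of half the fold angles of its creases stay proportional. Put $$p=\frac{1-\tan\frac{\pi}{2n}}{1+\tan\frac{\pi}{2n}} .$$ The speed coefficient at $c_i$ is $p_i=\tan(\tfrac12\text{fold angle of }s_{i+1})/\tan(\tfrac12\text{fold angle of }s_i)$; it equals $p$ in the mode called $+$ and $p^{-1}$ in the mode called $-$. **Folding modes of $DL(V,90^\circ)$.** A folding mode is an assignment of $+$ or $-$ to each vertex $c_0,\dots,c_{2n-1}$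 of the central polygon satisfying the rigid-foldability condition that the product of the speed coefficients around the central polygon is $1$; this condition is taken in the form that exactly $n$ of the vertices are assigned $+$ and $n$ are assigned $-$. Two folding modes are considered the same if their sign sequences differ by a cyclic shift (rotation of the polygon); sequences related only by reflection are considered different. *)

(* Defs.v *)
From HB Require Import structures.
From mathcomp Require Import all_boot all_order all_algebra.
From mathcomp Require Import boolp classical_sets reals trigo.
From mathcomp Require Import ring lra.

Set Implicit Arguments.
Unset Strict Implicit.
Unset Printing Implicit Defensive.

Import Order.TTheory GRing.Theory Num.Theory.
Local Open Scope ring_scope.

Section Plane.
Variable R : realType.
Definition plane : Type := (R * R)%type.
Implicit Types (a t : R) (u v : plane).

Definition shift_by v t u : plane := (v.1 + t * u.1, v.2 + t * u.2).
Definition vec u v : plane := (v.1 - u.1, v.2 - u.2).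
Definition dot u v : R := u.1 * v.1 + u.2 * v.2.
Definition cross u v : R := u.1 * v.2 - u.2 * v.1.
Definition rotate a u : plane :=
  (cos a * u.1 - sin a * u.2, sin a * u.1 + cos a * u.2).

Definition ray v u : set plane :=
  [set x | exists2 t, 0 <= t & x = shift_by v t u]%classic.
Definition segment u v : set plane :=
  [set x | exists2 t, 0 <= t <= 1 & x = shift_by u t (vec u v)]%classic.
End Plane.

(* Creases are listed counterclockwise; [ordS] is the cyclic successor, so
   crease indices are read modulo [m], and [sector i] is the angle from crease
   [i] to crease [i + 1]. *)
Record origami_vertex (R : realType) (m : nat) := OrigamiVertex {
  apex : plane R;
  dir : 'I_m -> plane R;
  sector : 'I_m -> R;
  dir_unit : forall i, dot (dir i) (dir i) = 1;
  sector_gt0 : forall i, 0 < sector i;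
  sector_sum : \sum_i sector i = 2 * pi;
  dir_succ : forall i, dir (ordS i) = rotate (sector i) (dir i)
}.

Definition symmetric_vertex (R : realType) (m : nat)
    (V : origami_vertex R m) : Prop :=
  forall i, sector V i = 2 * pi / m%:R.

(* The central polygon of a double-line pattern: side [i] joins corner [i - 1]
   to corner [i] ([ord_pred] is the cyclic predecessor). *)
Record double_line (R : realType) (m : nat) (V : origami_vertex R m) :=
  DoubleLine {
  corner : 'I_m -> plane R;
  corner_ccw : forall i,
    0 < cross (vec (apex V) (corner (ord_pred i))) (vec (apex V) (corner i));
  side_perp : forall i,
    dot (vec (corner (ord_pred i)) (corner i)) (dir V i) = 0;
  side_crosses : forall i, exists r s : R, [/\ 0 < r, 0 < s < 1 &
    shift_by (apex V) r (dir V i)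
    = shift_by (corner (ord_pred i)) s (vec (corner (ord_pred i)) (corner i))]
}.

Definition dl_creases (R : realType) (m : nat) (V : origami_vertex R m)
    (P : double_line V) : set (set (plane R)) :=
  [set l | exists i : 'I_m,
    [\/ l = segment (corner P (ord_pred i)) (corner P i),
        l = ray (corner P (ord_pred i)) (dir V i) |
        l = ray (corner P i) (dir V i)]]%classic.

(* A sign is a boolean, [true] being the mode +. *)
Definition speed_ratio (R : realType) (n : nat) : R :=
  (1 - tan (pi / (2 * n)%:R)) / (1 + tan (pi / (2 * n)%:R)).

Definition speed_coef (R : realType) (n : nat) (s : bool) : R :=
  if s then speed_ratio R n else (speed_ratio R n)^-1.

Definition balanced (n : nat) (mu : {ffun 'I_(2 * n) -> bool}) : bool :=
  (#|[set i | mu i]| == n) && (#|[set i | ~~ mu i]| == n).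

(* [balanced] is the rigid-foldability condition that the speed coefficients
   around the central polygon multiply to 1. For n = 2 the ratio is 0 and the
   coefficients degenerate, so [balanced] is the form used for every n. *)
Lemma balancedP (R : realType) (n : nat) (mu : {ffun 'I_(2 * n) -> bool}) :
  (2 < n)%N ->
  reflect (\prod_i speed_coef R n (mu i) = 1) (balanced mu).
Proof.
move=> n2.
have pi0 := @pi_gt0 R.
have nR : (2%:R : R) < n%:R by rewrite ltr_nat.
have n0 : (0 : R) < n%:R by lra.
have h0 : 0 < pi / (2 * n)%:R :> R.
  by rewrite divr_gt0 // ltr0n muln_gt0 /=; case: n n2 {mu nR n0}.
have h1 : pi / (2 * n)%:R < pi / 4 :> R.
  rewrite natrM ltr_pM2l // ltf_pV2 ?posrE; lra.
have tanlt x y : 0 <= x -> x < y -> y <= pi / 4 -> tan x < tan y :> R.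
  move=> x0 xy y4; rewrite ltr_tan // in_itv /=; apply/andP; split; lra.
have t0 : 0 < tan (pi / (2 * n)%:R) :> R.
  by have := tanlt _ _ (lexx 0) h0 (ltW h1); rewrite tan0.
have t1 : tan (pi / (2 * n)%:R) < 1 :> R.
  by have := tanlt _ _ (ltW h0) h1 (lexx _); rewrite tan_piquarter.
have p0 : 0 < speed_ratio R n by rewrite divr_gt0 //; lra.
have p1 : speed_ratio R n < 1.
  by rewrite /speed_ratio ltr_pdivrMr ?mul1r; lra.
set a := #|[set i | mu i]|; set b := #|[set i | ~~ mu i]|.
have abE : (a + b = 2 * n)%N.
  have -> : b = #|~: [set i | mu i]|.
    by apply: eq_card => i; rewrite !inE.
  by rewrite cardsC card_ord.
have -> : \prod_i speed_coef R n (mu i)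
          = speed_ratio R n ^+ a * (speed_ratio R n)^-1 ^+ b.
  rewrite (bigID (fun i => mu i)) /=; congr (_ * _).
    rewrite (eq_bigr (fun _ => speed_ratio R n)) => [|i mi].
      by rewrite prodr_const; congr (_ ^+ _); apply: eq_card => i; rewrite !inE.
    by rewrite /speed_coef mi.
  rewrite (eq_bigr (fun _ => (speed_ratio R n)^-1)) => [|i /negbTE mi].
    by rewrite prodr_const; congr (_ ^+ _); apply: eq_card => i; rewrite !inE.
  by rewrite /speed_coef mi.
rewrite exprVn.
have xb : speed_ratio R n ^+ b != 0 by rewrite expf_neq0 // gt_eqF.
rewrite /balanced -/a -/b.
apply: (iffP andP) => [[/eqP an /eqP bn]|e].
  by rewrite (etrans an (esym bn)) divff.
have {}e : speed_ratio R n ^+ a = speed_ratio R n ^+ b.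
  by rewrite -[RHS]mul1r -e mulfVK.
have ab : a = b.
  by apply/eqP; rewrite eqn_leq -!(ler_iXn2l p0 p1) e lexx.
by split; apply/eqP; apply/eqP; rewrite -(eqn_pmul2l (isT : (0 < 2)%N)) -abE;
  rewrite ab mul2n addnn.
Qed.

Definition folding_modes (R : realType) (n : nat)
    (V : origami_vertex R (2 * n)) (P : double_line V) :
    {set {ffun 'I_(2 * n) -> bool}} :=
  [set mu | balanced mu].

Definition rotate_mode (m k : nat) (mu : {ffun 'I_m -> bool}) :
    {ffun 'I_m -> bool} :=
  [ffun i => mu (iter k (@ordS m) i)].

Definition same_mode (m : nat) : rel {ffun 'I_m -> bool} :=
  fun mu nu => [exists k : 'I_m, nu == rotate_mode k mu].

Definition modes_up_to_rotation (R : realType) (n : nat)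
    (V : origami_vertex R (2 * n)) (P : double_line V) :
    {set {set {ffun 'I_(2 * n) -> bool}}} :=
  equivalence_partition (@same_mode (2 * n)) (folding_modes P).

(* Main.v *)
Require Import Defs.
From HB Require Import structures.
From mathcomp Require Import all_boot all_order all_algebra all_fingroup.
From mathcomp Require Import reals.
From mathcomp Require Import zify.

Set Implicit Arguments.
Unset Strict Implicit.
Unset Printing Implicit Defensive.

Import Order.TTheory GRing.Theory Num.Theory.

(** Burnside's lemma for the cyclic group of order [2 * n] acting on the
    balanced sign sequences by rotation. A sequence is fixed by rotation by [k]
    iff it has period [g = gcd (2 * n) k], and it is balanced iff its period
    is, which needs [g = 2 * d] and leaves ['C(2 * d, d)] choices. Exactly
    [totient (2 * n %/ g) = totient (n %/ d)] rotations [k] have this gcd. *)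

(** * Grouping the indices of a sum by residue, by multiple and by gcd *)

Lemma sum_nat_modn (q g : nat) (F : nat -> nat) :
  \sum_(0 <= i < q * g) F (i %% g) = q * \sum_(0 <= i < g) F i.
Proof.
rewrite big_nat_mul (eq_bigr (fun _ => \sum_(0 <= i < g) F i)) => [|j _].
  by rewrite sum_nat_const_nat subn0.
rewrite mulSn -{1}[(j * g)%N]add0n big_addn addnK !big_nat.
by apply: eq_bigr => i /= ig; rewrite addnC modnMDl modn_small.
Qed.

Lemma sum_nat_dvdn (e d : nat) (F : nat -> nat) : 0 < d ->
  \sum_(0 <= k < e * d | d %| k) F k = \sum_(0 <= j < e) F (j * d).
Proof.
move=> d0; rewrite big_mkcond big_nat_mul; apply: eq_bigr => j _.
(* In the block from [j * d] up to [j.+1 * d], the first index is the only multiple of [d]. *)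
rewrite big_ltn; last by rewrite ltn_pmul2r.
rewrite /= dvdn_mull // big_nat big1 ?addn0 // => i /andP[ji ij].
case: ifP => // /dvdnP[t ti]; move: ji ij; rewrite ti !ltn_pmul2r //; lia.
Qed.

(** Such a [k] is some [j * d], and with [m = e * d] the gcd is [gcdn e j * d], so the condition
    says that [j] is coprime to [e]. *)
Lemma count_gcdn_eq (m d : nat) : 0 < m -> d %| m ->
  \sum_(0 <= k < m) (gcdn m k == d) = totient (m %/ d).
Proof.
move=> m0 /dvdnP[e me]; move: m0; rewrite {}me => m0.
have [e0 d0] : 0 < e /\ 0 < d by move: m0; rewrite muln_gt0 => /andP[].
rewrite mulnK // totient_count_coprime.
transitivity (\sum_(0 <= k < e * d | d %| k) (gcdn (e * d) k == d : nat)).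
  rewrite [RHS]big_mkcond; apply: eq_bigr => k _; case: ifP => // dk.
  by case: eqP => // gd; move: dk; rewrite -gd dvdn_gcdr.
rewrite sum_nat_dvdn //; apply: eq_bigr => j _.
by rewrite -muln_gcdl /coprime -{2}[d]mul1n eqn_pmul2r.
Qed.

(** The bound [N] is left free so that it can later be matched to the even values of [g]. It must
    exceed [m], a gcd attained at [k = 0]. *)
Lemma sum_gcdn (m N : nat) (F : nat -> nat) : 0 < m < N ->
  \sum_(0 <= k < m) F (gcdn m k)
  = \sum_(0 <= g < N | g %| m) totient (m %/ g) * F g.
Proof.
move=> /andP[m0 mN].
transitivity (\sum_(0 <= k < m) \sum_(0 <= g < N | g %| m)
                (gcdn m k == g) * F g).
  apply: eq_bigr => k _.
  have gN : gcdn m k < N.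
    by apply: leq_ltn_trans mN; rewrite dvdn_leq ?dvdn_gcdl.
  rewrite !big_mkord (bigD1 (Ordinal gN)) /= ?dvdn_gcdl //.
  rewrite eqxx mul1n big1 ?addn0 // => g /andP[_ gne].
  rewrite (_ : (_ == _) = false) //.
  by apply: contraNF gne => /eqP gE; apply/eqP/val_inj.
rewrite exchange_big /=; apply: eq_bigr => g gm.
by rewrite -big_distrl /= count_gcdn_eq.
Qed.

(** * Rotations of a cyclic sequence *)

Section Rotation.
Variable m : nat.
Implicit Types (i : 'I_m) (mu : {ffun 'I_m -> bool}).

Lemma val_iter_ordS k i : iter k (@ordS m) i = (i + k) %% m :> nat.
Proof.
elim: k => [|k IHk] /=; first by rewrite addn0 modn_small.
by rewrite IHk -addn1 modnDml addn1 addnS.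
Qed.

Lemma rotate_modeD j k mu :
  rotate_mode (j + k) mu = rotate_mode j (rotate_mode k mu).
Proof. by apply/ffunP => i; rewrite !ffunE addnC iterD. Qed.

Lemma rotate_mode_modn k mu : rotate_mode (k %% m) mu = rotate_mode k mu.
Proof.
by apply/ffunP => i; rewrite !ffunE; congr (mu _); apply/val_inj;
  rewrite /= !val_iter_ordS modnDmr.
Qed.

Lemma rotate_mode0 mu : rotate_mode 0 mu = mu.
Proof. by apply/ffunP => i; rewrite ffunE. Qed.

Lemma rotate_mode_fixM k q mu :
  rotate_mode k mu = mu -> rotate_mode (q * k) mu = mu.
Proof.
move=> fk; elim: q => [|q IHq]; first by rewrite rotate_mode0.
by rewrite mulSn rotate_modeD IHq.
Qed.

(** The shifts fixing [mu] are closed under addition and contain the multiples of [m], so Bezout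
    puts [gcdn m k] among them once [k] is. *)
Lemma rotate_mode_fix_gcdn k mu :
  (rotate_mode k mu == mu) = (rotate_mode (gcdn m k) mu == mu).
Proof.
apply/eqP/eqP => [fk|fg]; last first.
  by have /dvdnP[q ->] := dvdn_gcdr m k; apply: rotate_mode_fixM.
have [->|k0] := posnP k.
  by rewrite gcdn0 -rotate_mode_modn modnn rotate_mode0.
(* Here [u * k = v * m + gcdn k m]: the trivial shift by [v * m] followed by the shift by the gcd is
   a shift by a multiple of [k]. *)
case: (egcdnP m k0) => u v uv _; rewrite gcdnC.
rewrite -{1}(rotate_mode_fixM v (_ : rotate_mode m mu = mu)); last first.
  by rewrite -rotate_mode_modn modnn rotate_mode0.
by rewrite -rotate_modeD addnC -uv rotate_mode_fixM.
Qed.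


Lemma card_rotate_mode k mu :
  #|[set i | rotate_mode k mu i]| = #|[set i | mu i]|.
Proof.
rewrite -[RHS](card_preimset _ (_ : injective (iter k (@ordS m)))).
  by apply: eq_card => i; rewrite !inE ffunE.
by elim: k => [|k IHk] // x y /= /ordS_inj /IHk.
Qed.

End Rotation.

(** * Sequences of period [g] as subsets of one period *)

Section Inflation.
Variables (m g : nat) (g_gt0 : 0 < g).
Hypothesis g_dvd_m : g %| m.

Definition inflate (A : {set 'I_g}) : {ffun 'I_m -> bool} :=
  [ffun i : 'I_m => Ordinal (ltn_pmod i g_gt0) \in A].

Lemma inflate_inj : 0 < m -> injective inflate.
Proof.
move=> m0 A B /ffunP AB; apply/setP => i.
have im : i < m by apply: leq_trans (ltn_ord i) (dvdn_leq m0 g_dvd_m).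
have := AB (Ordinal im); rewrite !ffunE /=.
by rewrite (_ : Ordinal _ = i) //; apply/val_inj; rewrite /= modn_small.
Qed.

(** The sequence consists of [m %/ g] full copies of the window coded by [A]. *)
Lemma card_inflate A : #|[set i | inflate A i]| = m %/ g * #|A|.
Proof.
pose F j := (Ordinal (ltn_pmod j g_gt0) \in A : nat).
have FE j : F (j %% g) = F j.
  rewrite /F; congr (nat_of_bool (_ \in A)).
  by apply/val_inj; rewrite /= modn_mod.
have -> : #|A| = \sum_(0 <= j < g) F j.
  rewrite big_mkord -sum1_card big_mkcond; apply: eq_bigr => j _.
  by rewrite /F (_ : Ordinal _ = j) //; apply/val_inj; rewrite /= modn_small.
rewrite -sum_nat_modn divnK // big_mkord -sum1_card big_mkcond.
by apply: eq_bigr => i _; rewrite inE ffunE FE /F; case: (_ \in A).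
Qed.

Lemma rotate_mode_fix_inflate mu :
  (rotate_mode g mu == mu) = (mu \in [set inflate A | A : {set 'I_g}]).
Proof.
apply/eqP/imsetP => [fg|[A _ ->]]; last first.
  apply/ffunP => i; rewrite !ffunE; congr (_ \in A).
  by apply/val_inj; rewrite /= val_iter_ordS modn_dvdm // modnDr.
(* The + positions of the first window. The existential replaces a cast of [j] into ['I_m], which is
   empty when [m = 0]. *)
exists [set j : 'I_g | [exists i : 'I_m, (i == j :> nat) && mu i]] => //.
apply/ffunP => i; rewrite ffunE inE.
have im : i %% g < m by apply: leq_ltn_trans (leq_mod _ _) (ltn_ord i).
have -> : mu i = mu (Ordinal im).
  (* Moving [i %% g] forward by [i %/ g] periods lands on [i] without wrapping around. *)
  have /ffunP/(_ (Ordinal im)) := rotate_mode_fixM (i %/ g) fg.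
  rewrite ffunE => <-; congr (mu _); apply/val_inj.
  by rewrite /= val_iter_ordS /= addnC -divn_eq modn_small.
apply/idP/existsP => [mi|[j /andP[/eqP ji mj]]].
  by exists (Ordinal im); rewrite eqxx.
by rewrite (_ : Ordinal im = j) //; apply/val_inj.
Qed.

Lemma card_rotate_mode_fix a : 0 < m ->
  #|[set mu : {ffun 'I_m -> bool} | (#|[set i | mu i]| == a)
                                     && (rotate_mode g mu == mu)]|
  = #|[set A : {set 'I_g} | m %/ g * #|A| == a]|.
Proof.
move=> m0; rewrite -(card_imset _ (inflate_inj m0)).
apply: eq_card => mu; rewrite !inE rotate_mode_fix_inflate.
apply/andP/imsetP => [[mua /imsetP[A _ muE]]|[A]].
  by exists A => //; rewrite inE -card_inflate -muE.
by rewrite inE -card_inflate => Aa ->; rewrite imset_f.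
Qed.

End Inflation.

(** * Burnside's lemma for rotations *)

Section Orbits.
Variable m : nat.
Implicit Types mu nu : {ffun 'I_m.+1 -> bool}.

(** The length is a successor because ['I_m.+1] carries the group law of addition modulo [m.+1]. *)
Lemma rotate_mode_is_action :
  is_action [set: 'I_m.+1] (fun mu (k : 'I_m.+1) => rotate_mode k mu).
Proof.
apply: is_total_action => [mu|mu j k]; first exact: rotate_mode0.
by rewrite /= rotate_mode_modn addnC rotate_modeD.
Qed.
Canonical rotate_mode_action := Action rotate_mode_is_action.

Lemma burnside_rotate_modeS (S : {set {ffun 'I_m.+1 -> bool}}) :
  (forall k mu, mu \in S -> rotate_mode k mu \in S) ->
  #|equivalence_partition (@same_mode m.+1) S| * m.+1
  = \sum_(0 <= k < m.+1) #|[set mu in S | rotate_mode k mu == mu]|.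
Proof.
move=> rotS.
have actS : [acts [set: 'I_m.+1], on S | rotate_mode_action].
  apply/subsetP => k _; rewrite !inE.
  by apply/subsetP => mu muS; rewrite inE; apply: rotS.
have := Frobenius_Cauchy actS; rewrite cardsT card_ord big_mkord => Burn.
(* As [S] is stable under rotation, the class of [mu] within [S] is its whole orbit. *)
rewrite (_ : equivalence_partition _ S
           = orbit rotate_mode_action [set: 'I_m.+1] @: S).
  rewrite -Burn; apply: eq_big => [k|k _]; first by rewrite inE.
  by apply: eq_card => mu; rewrite !inE sub1set inE.
apply: eq_in_imset => mu muS; apply/setP => nu; rewrite !inE.
apply/andP/orbitP => [[_ /existsP[k /eqP ->]]|[k _ <-]].
  by exists k; rewrite ?inE.
by split; [exact: rotS | apply/existsP; exists k].
Qed.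

End Orbits.

Lemma burnside_rotate_mode (m : nat) (S : {set {ffun 'I_m -> bool}}) :
  0 < m -> (forall k mu, mu \in S -> rotate_mode k mu \in S) ->
  #|equivalence_partition (@same_mode m) S| * m
  = \sum_(0 <= k < m) #|[set mu in S | rotate_mode k mu == mu]|.
Proof. by case: m S => // m S _; apply: burnside_rotate_modeS. Qed.

(** * Counting balanced sequences *)

Lemma balancedE (n : nat) (mu : {ffun 'I_(2 * n) -> bool}) :
  balanced mu = (#|[set i | mu i]| == n).
Proof.
rewrite /balanced andb_idr // => /eqP mun.
have -> : [set i | ~~ mu i] = ~: [set i | mu i].
  by apply/setP => i; rewrite !inE.
by rewrite cardsCs setCK card_ord mun mul2n -addnn addnK.
Qed.

(** A window of length [g] repeated [2 * n %/ g] times has [n] signs + exactly when half of the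
    window is +, which is impossible for odd [g]. *)
Lemma card_balanced_fix (n k : nat) : 0 < n ->
  #|[set mu : {ffun 'I_(2 * n) -> bool} | balanced mu
                                          && (rotate_mode k mu == mu)]|
  = let g := gcdn (2 * n) k in if 2 %| g then 'C(g, g %/ 2) else 0.
Proof.
move=> n0 /=; set g := gcdn _ _.
have m0 : 0 < 2 * n by rewrite muln_gt0.
have g0 : 0 < g by rewrite gcdn_gt0 m0.
have gm : g %| 2 * n by apply: dvdn_gcdl.
under eq_finset do rewrite balancedE rotate_mode_fix_gcdn -/g.
rewrite card_rotate_mode_fix //.
have q0 : 0 < 2 * n %/ g by rewrite divn_gt0 // dvdn_leq.
have quotE (a : nat) : (2 * n %/ g * a == n) = (a * 2 == g).
  rewrite -(eqn_pmul2l (isT : 0 < 2)) mulnCA -{2}(divnK gm) eqn_pmul2l //.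
  by rewrite mulnC.
under eq_finset do rewrite quotE.
case: ifP => [g2|g2].
  have := card_draws 'I_g (g %/ 2); rewrite card_ord => <-.
  apply: eq_card => A; rewrite !inE.
  by rewrite eqn_div.
apply: eq_card0 => A; rewrite inE; apply/negbTE; apply: contraFN g2.
by move/eqP => <-; apply: dvdn_mull.
Qed.

Local Open Scope ring_scope.

Theorem theorem3 (R : realType) (n : nat) (hn : (0 < n)%N)
    (V : origami_vertex R (2 * n)) (hV : symmetric_vertex V)
    (P : double_line V) :
  (#|modes_up_to_rotation P|)%:R
  = (2 * n)%:R^-1
    * \sum_(1 <= d < n.+1 | (d %| n)%N)
        (totient (n %/ d) * 'C(2 * d, d))%:R :> rat.
Proof.
rewrite -natr_sum; set s := (\sum_(_ <= _ < _ | _) _)%N.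
suff e : (#|modes_up_to_rotation P| * (2 * n) = s)%N.
  rewrite -e [X in _ * X]natrM mulrCA mulVf ?mulr1 //.
  by rewrite pnatr_eq0 muln_eq0 /= -lt0n.
have m0 : (0 < 2 * n)%N by rewrite muln_gt0.
rewrite burnside_rotate_mode // => [|k mu]; last first.
  by rewrite !inE !balancedE card_rotate_mode.
under eq_bigr => k _.
  under eq_finset do rewrite inE.
  rewrite card_balanced_fix //; over.
(* With this bound, the even [g] in range are the [d * 2] with [d] at most [n]. *)
rewrite /= (sum_gcdn (N := n.+1 * 2)
  (fun g => if (2 %| g)%N then 'C(g, g %/ 2) else 0%N)); last lia.
rewrite big_mkcond /=.
transitivity (\sum_(0 <= g < n.+1 * 2 | 2 %| g)
  (if g %| 2 * n then totient (2 * n %/ g) * 'C(g, g %/ 2) else 0))%N.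
  rewrite [RHS]big_mkcond; apply: eq_bigr => g _.
  by do 2 case: ifP => // _; rewrite muln0.
(* The term [d = 0] vanishes because 0 does not divide [2 * n], so the sum starts at 1. *)
rewrite sum_nat_dvdn // big_ltn // mul0n dvd0n -[(2 * n == 0)%N]negbK -lt0n m0.
rewrite /= add0n [RHS]big_mkcond; apply: eq_bigr => d _.
by rewrite [(d * 2)%N]mulnC dvdn_pmul2l // divnMl // mulKn.
Qed.
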